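(* For every pair of real numbers $s<t$ there exist constants $c$ and $0<\rho<1$, depending only on $s,t$, such that the following holds. Let $(X_n)_{n=1}^\infty$ be a $\{0,1\}$-valued stationary process and let $S_n=\frac1n I(X_1,\dots,X_n)$. Then for every positive integer $k$, $$\mathbb P\big((S_n)_{n=1}^\infty \text{ has } k\text{ upcrossings of }[s,t]\big)<c\cdot\rho^k .$$
   Context: For a fixed finite sequence $\xi=(\xi_1,\dots,\xi_n)$ let $\mathbb P(\xi)=\mathbb P(X_1=\xi_1,\dots,X_n=\xi_n)$. The information of the sample is the random variable $I(X_1,\dots,X_n)=-\log_2\mathbb P(X_1,\dots,X_n)$, i.e. minus the base-2 logarithm of the probability of the sample actually observed. A sequence $(x_n)_{n=1}^\infty$ of real numbers has $k$ upcrossings of $[s,t]$ if there are indices $1\le i_1<j_1<i_2<j_2<\cdots<i_k<j_k$ such that $x_{i_m}<s$ and $x_{j_m}>t$ for $m=1,\dots,k$. *)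

(* Defs.v *)
From mathcomp Require Import all_boot all_order all_algebra.
From mathcomp Require Import all_classical all_reals all_analysis.

Set Implicit Arguments.
Unset Strict Implicit.
Unset Printing Implicit Defensive.

Import Order.TTheory GRing.Theory Num.Theory.

Local Open Scope classical_set_scope.
Local Open Scope ring_scope.

(* A process (X_n)_{n >= 1} is represented as X : nat -> {RV P >-> bool}, where
   X i stands for X_{i+1}; the values 0, 1 are false, true. *)

(* (X_{m+1}, ..., X_{m+n}) *)
Definition block d (T : measurableType d) (R : realType) (P : probability T R)
    (X : nat -> {RV P >-> bool}) (m n : nat) (w : T) : n.-tuple bool :=
  [tuple X (m + i)%N w | i < n].

Definition stationary d (T : measurableType d) (R : realType)
    (P : probability T R) (X : nat -> {RV P >-> bool}) : Prop :=
  forall (m n : nat) (xi : n.-tuple bool),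
    P [set w | block X m n w = xi] = P [set w | block X 0 n w = xi].

Definition pathprob d (T : measurableType d) (R : realType)
    (P : probability T R) (X : nat -> {RV P >-> bool}) (n : nat)
    (xi : n.-tuple bool) : R :=
  fine (P [set w | block X 0 n w = xi]).

Definition log2 (R : realType) (x : R) : R := ln x / ln 2.

(* Since ln 0 = 0, the information is 0 where the observed sample has
   probability 0; this happens only on a null event. *)
Definition information d (T : measurableType d) (R : realType)
    (P : probability T R) (X : nat -> {RV P >-> bool}) (n : nat) (w : T) : R :=
  - log2 (pathprob X (block X 0 n w)).

(* S_n; only the values n >= 1 are meaningful. *)
Definition information_rate d (T : measurableType d) (R : realType)
    (P : probability T R) (X : nat -> {RV P >-> bool}) (n : nat) (w : T) : R :=
  n%:R^-1 * information X n w.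

(* The sequence is (x_n)_{n >= 1}: the value x 0 is never used. The indices
   i_1, j_1, ..., i_k, j_k are i 0, j 0, ..., i k.-1, j k.-1. *)
Definition has_upcrossings (R : realType) (k : nat) (s t : R) (x : nat -> R) :
    Prop :=
  exists i j : nat -> nat,
    [/\ forall m, (m < k)%N -> (1 <= i m < j m)%N,
        forall m, (m.+1 < k)%N -> (j m < i m.+1)%N &
        forall m, (m < k)%N -> x (i m) < s /\ t < x (j m)].

(* Main.v *)
Require Import Defs.
From mathcomp Require Import all_boot all_order all_algebra.
From mathcomp Require Import all_classical all_reals all_analysis.
From mathcomp Require Import ring lra zify.

Import Order.TTheory GRing.Theory Num.Theory.

Local Open Scope classical_set_scope.
Local Open Scope ring_scope.

(** Write mu(w) for the probability of the word w and I(w) = - ln mu(w); the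
    logarithm is natural, so s and t get multiplied by ln 2.  Upcrossings of
    [s, t] starting at time a are nested blocks [a, a + i_1), [a, a + j_1),
    [a, a + i_2), ... on which I is alternately below s and above t times the
    length.  Since I increases with the block, i_(m+1) > (t / s) j_m, so the
    block lengths grow geometrically (upcrossing_lengths); keeping only every
    g-th block makes them grow by any prescribed factor K.

    Coding.  There is a weight on words, of total mass at most 1 on each length,
    for which the code length J(w) = - ln weight is at most the sum of I + eps *
    length over any disjoint subblocks of length at least l0, plus 3 for each
    letter outside them (code_weight_cons, code_weight_cat,
    sum_code_weight_le1).  As the mass is at most 1, a word of length n has
    probability at most exp (- (t - tau) n) to satisfy both I > t n and
    J < tau n (compressible_prob).  If there are k upcrossings, then all but r
    of the blocks have length at least r, so for r proportional to k the event
    that one of them is compressible has exponentially small probability.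

    Covering.  Consider a window of length N and the times a at which there are
    k upcrossings and no compressible block.  Let A_l be the union of the blocks
    [a, a + v_l) on which I is large, v_l being the l-th length kept.  Each point
    of A_l starts a block on which I is small, of length about u_l with
    v_l << u_l << v_(l+1).  If A_l almost filled a block [a, a + v_(l+1)), then
    so would the disjoint blocks obtained by repeatedly taking the first point
    of A_l that is still uncovered, and [a, a + v_(l+1)) would be compressible
    (fill_bound).  The only obstruction is a small-information block that sticks
    out far to the right; but then the next large block from its start is so
    much longer that the current one may be neglected (growth_step).  Hence the
    sets A_l grow by a factor 1 + theta at each of r steps
    (alternation_density), and as A_r fits in the window, the good times a have
    density at most (1 + theta)^(- r).

    Stationarity turns this density into a probability (typical_prob).  The
    argument only sees words of a finite length M, and the bound does not depend
    on M, so the theorem follows by continuity of the measure. *)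

(** * Powers and geometric sums *)

Lemma bernoulli_ge (R : realFieldType) (x : R) (n : nat) :
  -1 <= x -> 1 + n%:R * x <= (1 + x) ^+ n.
Proof.
move=> x1; elim: n => [|n IH]; first by rewrite mul0r addr0 expr0.
rewrite exprS -natr1.
have [/ltW h|h] := ltP (1 + n%:R * x) 0.
  have [x0|x0] := leP 0 x.
    have := ler0n R n; move=> hn.
    have : 0 <= n%:R * x by apply: mulr_ge0.
    by move=> ?; lra.
  apply: le_trans (_ : 0 <= _); last by apply: mulr_ge0; [lra|apply: exprn_ge0; lra].
  lra.
apply: le_trans (_ : (1 + x) * (1 + n%:R * x) <= _); last by apply: ler_wpM2l => //; lra.
have : 0 <= n%:R * x ^+ 2 by apply: mulr_ge0 => //; apply: sqr_ge0.
rewrite expr2; nra.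
Qed.

Lemma expr_unbounded (R : archiRealFieldType) (x K : R) :
  1 < x -> exists n : nat, K <= x ^+ n.
Proof.
move=> x1.
have x0 : 0 < x - 1 by rewrite subr_gt0.
have := truncnS_gt (K / (x - 1)); set n := _.+1 => hn; exists n.
have -> : x = 1 + (x - 1) by ring.
apply: le_trans (bernoulli_ge _ _ _ _); last by lra.
by move: hn; rewrite ltr_pdivrMr // => h; lra.
Qed.

Lemma geometric_tail_le (R : realFieldType) (q : R) (m n : nat) :
  0 <= q < 1 -> \sum_(m <= l < n) q ^+ l <= q ^+ m / (1 - q).
Proof.
move=> /andP[q0 q1].
have p : 0 < 1 - q by rewrite subr_gt0.
rewrite ler_pdivlMr //.
have [nm|mn] := leqP n m; first by rewrite big_geq // mul0r exprn_ge0.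
suff -> : (\sum_(m <= l < n) q ^+ l) * (1 - q) = q ^+ m - q ^+ n.
  by have := exprn_ge0 n q0; lra.
rewrite -[RHS]opprB -(telescope_sumr (fun i => q ^+ i) (ltnW mn)) -sumrN big_distrl.
by apply: eq_bigr => i _; rewrite /= opprB mulrBr mulr1 -exprSr.
Qed.

(** * Counting and covering on the integers *)

Definition count_in (P : pred nat) (p q : nat) : nat := \sum_(p <= i < q) P i.

Lemma count_in_cat P p q r : (p <= q <= r)%N ->
  count_in P p r = (count_in P p q + count_in P q r)%N.
Proof. by move=> /andP[pq qr]; rewrite /count_in (big_cat_nat pq qr). Qed.

Lemma count_in_recl P p q : (p < q)%N ->
  count_in P p q = (P p + count_in P p.+1 q)%N.
Proof. by move=> pq; rewrite /count_in big_ltn. Qed.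

Lemma count_in_geq P p q : (q <= p)%N -> count_in P p q = 0%N.
Proof. by move=> pq; rewrite /count_in big_geq. Qed.

Lemma count_in_le_length P p q : (count_in P p q <= q - p)%N.
Proof.
rewrite /count_in; apply: (@leq_trans (\sum_(p <= i < q) 1)).
  by apply: leq_sum => i _; apply: leq_b1.
by rewrite sum_nat_const_nat muln1.
Qed.

Lemma sub_count_in (P Q : pred nat) p q :
  (forall i, (p <= i < q)%N -> P i -> Q i) -> (count_in P p q <= count_in Q p q)%N.
Proof.
move=> PQ; rewrite /count_in big_nat_cond [in leqRHS]big_nat_cond.
apply: leq_sum => i /andP[/PQ pq _].
by case: (P i) pq => [->|].
Qed.

Lemma count_inU (P Q : pred nat) p q :
  (count_in (fun i => P i || Q i) p q <= count_in P p q + count_in Q p q)%N.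
Proof.
rewrite /count_in -big_split /=; apply: leq_sum => i _.
by case: (P i); case: (Q i).
Qed.

(** The points at distance less than c from the end e form an interval of length
    at most c. *)
Lemma count_near_end (R : realFieldType) (c : R) (p e : nat) : 0 <= c ->
  (count_in (fun q => (e - q)%:R < c) p e)%:R <= c.
Proof.
move=> c0; have [n] := ubnP (e - p); elim: n p => // n IH p pn.
have [ep|pe] := leqP e p; first by rewrite count_in_geq.
have [ec|ce] := ltP (e - p)%:R c.
  by apply: le_trans (ltW ec); rewrite ler_nat count_in_le_length.
by rewrite (count_in_recl _ p) // ltNge ce /= add0n; apply: IH; lia.
Qed.

(** In the application, [x, b x) is a block on which the information is small
    and [x, e x) a much longer one on which it is large.  A block [x, e x) is
    good if no short block starting in it sticks out by a start at distance
    more than theta (e x - x) from the end; by the last hypothesis a good block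
    contains at least 2 theta (e x - x) points outside A.  If the short block
    from q in [x, e x) makes it bad, then [q, e q) is at least twice as long
    as [x, e x).  The downward induction on p therefore proves the bound for
    #A in [p, N) with the bonus e p - p for p in A: a good block pays for
    itself twice, and a bad one is paid for by the bonus of q.  So no disjoint
    family has to be extracted. *)
Lemma growth_step (R : realFieldType) (theta K : R) (N : nat)
    (A A' : pred nat) (b e : nat -> nat) :
  0 <= theta -> 2 <= K * theta ->
  (forall x, A x -> [/\ x < b x, b x <= e x & e x <= N]%N) ->
  (forall x, A x -> K * (b x - x)%:R <= (e x - x)%:R) ->
  (forall x q, A x -> (x <= q < e x)%N -> A' q) ->
  (forall x, A x -> 3 * theta * (e x - x)%:R <=
     (count_in (fun q => ~~ (A q && (b q <= e x)%N)) x (e x))%:R) ->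
  (1 + theta) * (count_in A 0 N)%:R <= (count_in A' 0 N)%:R.
Proof.
move=> th0 Kth hbe hK hA' hfill.
pose D q := A' q && ~~ A q.
have AA' x : A x -> A' x.
  by move=> Ax; have [] := hbe x Ax; move=> *; apply: (hA' x x Ax); lia.
have K0 : 0 <= K.
  rewrite leNgt; apply/negP => K0.
  have : K * theta <= 0 by rewrite mulr_le0_ge0 // ltW.
  lra.
suff key p : (p <= N)%N ->
    theta * (count_in A p N)%:R <= (count_in D p N)%:R /\
    (A p -> theta * (count_in A p N + (e p - p))%:R <= (count_in D p N)%:R).
  have [h _] := key 0%N (leq0n N).
  have : (count_in A 0 N + count_in D 0 N <= count_in A' 0 N)%N.
    rewrite /count_in -big_split /=; apply: leq_sum => i _; rewrite /D.
    by have := AA' i; case: (A i) => [->|] //; case: (A' i).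
  by rewrite -(ler_nat R) natrD mulrDl mul1r; lra.
have [n] := ubnP (N - p); elim: n p => // n IH p pn pN.
have [Ap|nAp] := boolP (A p); last first.
  split=> //.
  have [Np|{}pN] := leqP N p; first by rewrite !count_in_geq // mulr0.
  rewrite (count_in_recl A p) // (count_in_recl D p) // (negbTE nAp) add0n natrD.
  have [|h _] := IH p.+1 _ pN; first by lia.
  by apply: (le_trans h); rewrite lerDr.
suff h : theta * (count_in A p N + (e p - p))%:R <= (count_in D p N)%:R.
  split=> // ; apply: le_trans h; apply: ler_wpM2l => //.
  by rewrite ler_nat leq_addr.
have [pb be eN] := hbe p Ap.
(* The witness of badness: q starts a short block that ends beyond e p. *)
pose far q := [&& A q, (e p < b q)%N & theta * (e p - p)%:R <= (e p - q)%:R].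
have [/existsP[[q /= qN] /and3P[pq qe /and3P[Aq eb hq]]]|/existsPn good] :=
    boolP [exists q : 'I_N, [&& (p <= q)%N, (q < e p)%N & far q]].
  have [qb bq eqN] := hbe q Aq.
  have npq : p != q by apply: contraTneq eb => <-; rewrite -leqNgt.
  have [||_ /(_ Aq)] := IH q; [lia|lia|].
  have long : (2 * (e p - p) <= e q - q)%N.
    rewrite -(ler_nat R) natrM; apply: le_trans (hK q Aq).
    apply: (@le_trans _ _ (K * (e p - q)%:R)); last first.
      by apply: ler_wpM2l => //; rewrite ler_nat; lia.
    apply: (@le_trans _ _ (K * (theta * (e p - p)%:R))); last exact: ler_wpM2l.
    by rewrite mulrA ler_wpM2r.
  move=> IHq; apply: (@le_trans _ _ (count_in D q N)%:R); last first.
    by rewrite ler_nat (count_in_cat D p q N) ?leq_addl //; lia.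
  apply: le_trans IHq; apply: ler_wpM2l => //; rewrite ler_nat.
  rewrite (count_in_cat A p q N); last by lia.
  have := count_in_le_length A p q; lia.
have [||IHe _] := IH (e p); [lia|lia|].
have short : (count_in (fun q => ~~ (A q && (b q <= e p)%N)) p (e p)
    <= count_in D p (e p) +
       count_in (fun q => ((e p - q)%:R < theta * (e p - p)%:R)%R) p (e p))%N.
  apply: leq_trans (count_inU _ _ _ _); apply: sub_count_in => q /andP[pq qe].
  have A'q : A' q by apply: (hA' p) => //; rewrite pq.
  rewrite /D A'q /=; case: (boolP (A q)) => //= Aq; rewrite -ltnNge => eb.
  have qN : (q < N)%N by lia.
  have := good (Ordinal qN); rewrite /= pq qe /far Aq eb /= -ltNge.
  by [].
have near : (count_in (fun q => ((e p - q)%:R < theta * (e p - p)%:R)%R) p (e p))%:R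
    <= theta * (e p - p)%:R :> R by apply: count_near_end; apply: mulr_ge0.
have := hfill p Ap; move: short; rewrite -(ler_nat R) natrD => short fill.
rewrite (count_in_cat D p (e p) N) ?(count_in_cat A p (e p) N); try lia.
have : (count_in A p (e p))%:R <= (e p - p)%:R :> R.
  by rewrite ler_nat count_in_le_length.
move/(ler_wpM2l th0); rewrite !natrD !mulrDr => cA.
lra.
Qed.

(** Greedy filling: going from left to right, the block [q, b q) is used whenever
    q is in A and the block fits, and otherwise one letter is paid at the flat
    price 3. *)
Lemma fill_bound (R : realFieldType) (sigma : R) (A : pred nat) (b : nat -> nat)
    (e : nat) (J : nat -> R) :
  0 <= sigma -> J e <= 0 ->
  (forall p, (p < e)%N -> J p <= 3 + J p.+1) ->
  (forall p, A p -> (p < b p)%N) ->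
  (forall p, A p -> (b p <= e)%N ->
     J p <= sigma * (b p - p)%:R + J (b p)) ->
  forall p, (p <= e)%N ->
  J p <= sigma * (e - p)%:R +
         3 * (count_in (fun q => ~~ (A q && (b q <= e)%N)) p e)%:R.
Proof.
move=> sg0 Je Jfree hb Jblock p; have [n] := ubnP (e - p); elim: n p => // n IH p pn.
rewrite leq_eqVlt => /predU1P[->|pe].
  by rewrite subnn count_in_geq // !mulr0 addr0.
have [/andP[Ap bpe]|bad] := boolP (A p && (b p <= e)%N).
  have pb := hb p Ap; apply: le_trans (Jblock p Ap bpe) _.
  apply: le_trans (lerD (lexx _) (IH (b p) _ bpe)) _; first by lia.
  rewrite addrA -mulrDr -natrD (_ : b p - p + (e - b p) = e - p)%N; last by lia.
  by rewrite lerD2l ler_pM2l // ler_nat (count_in_cat _ p (b p) e) ?leq_addl //; lia.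
apply: le_trans (Jfree p pe) _.
apply: le_trans (lerD (lexx _) (IH p.+1 _ pe)) _; first by lia.
rewrite (count_in_recl _ p) // bad natrD.
have : sigma * (e - p.+1)%:R <= sigma * (e - p)%:R.
  by apply: ler_wpM2l => //; rewrite ler_nat; lia.
by move=> ?; rewrite mulrDr mulr1; lra.
Qed.

Lemma free_bound (R : realFieldType) (e : nat) (J : nat -> R) :
  (forall p, (p < e)%N -> J p <= 3 + J p.+1) ->
  forall a x, (a <= x <= e)%N -> J a <= 3 * (x - a)%:R + J x.
Proof.
move=> Jfree a x /andP[ax xe]; have [n] := ubnP (x - a).
elim: n a ax => // n IH a; rewrite leq_eqVlt => /predU1P[->|ax] an.
  by rewrite subnn mulr0 add0r.
apply: le_trans (Jfree a _) _; first by lia.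
apply: le_trans (lerD (lexx _) (IH a.+1 ax _)) _; first by lia.
by rewrite (_ : x - a = (x - a.+1).+1)%N; [rewrite -natr1; lra|lia].
Qed.

(** L p q and J p q stand for the information and the code length of the block
    [p, q).  From each a in pts, the blocks of length u a l have small L and
    those of length v a l.+1 have large J, with v a l << u a l << v a l.+1.  The
    sets A l below grow by the factor 1 + theta at each step: a point x of A l
    lies in some [a, a + v a l), hence [x, a + u a l) still has small L because
    only a negligible initial part is cut off, and if x starts a block
    [x, a + v a l.+1) almost filled by such blocks, then J a (a + v a l.+1)
    would be too small. *)
Lemma alternation_density (R : realFieldType) (s eps theta K : R) (N l0 r : nat)
    (L J : nat -> nat -> R) (pts : nat -> Prop) (u v : nat -> nat -> nat) :
  0 <= s -> 0 < eps -> 0 < theta -> 2 <= K -> 2 <= K * theta ->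
  s + eps <= K * eps ->
  (forall p p' q, (p <= p' <= q)%N -> (q <= N)%N -> L p' q <= L p q) ->
  (forall q, J q q <= 0) ->
  (forall p q, (p < q <= N)%N -> J p q <= 3 + J p.+1 q) ->
  (forall p m q, (p + l0 <= m)%N -> (m <= q <= N)%N ->
     J p q <= L p m + eps * (m - p)%:R + J m q) ->
  (forall a l, pts a -> (l <= r)%N ->
     [/\ (0 < v a l)%N, (l0 <= v a l)%N & (a + v a l <= N)%N]) ->
  (forall a l, pts a -> (l < r)%N ->
     [/\ K * (v a l)%:R <= (u a l)%:R, K * (u a l)%:R <= (v a l.+1)%:R,
         L a (a + u a l)%N <= s * (u a l)%:R &
         (s + 2 * eps + 12 * theta) * (v a l.+1)%:R <= J a (a + v a l.+1)%N]) ->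
  (1 + theta) ^+ r * (count_in (fun a => `[< pts a >]) 0 N)%:R <= N%:R.
Proof.
move=> s0 eps0 th0 K2 Kth Keps Lmono J0 Jfree Jblock hv hup.
pose A l x := `[< exists2 a, pts a & (a <= x < a + v a l)%N >].
have step l : (l < r)%N ->
    (1 + theta) * (count_in (A l) 0 N)%:R <= (count_in (A l.+1) 0 N)%:R.
  move=> lr.
  (* f x is a point of pts whose level-l block contains x. *)
  have [f fP] : {f : nat -> nat & forall x, A l x ->
      pts (f x) /\ (f x <= x < f x + v (f x) l)%N}.
    apply: (@choice _ _ (fun x a => A l x -> pts a /\ (a <= x < a + v a l)%N)) => x.
    have [/asboolP[a pa ax]|nA] := boolP (A l x); last by exists 0%N.
    by exists a.
  have le2 (m n : nat) : K * m%:R <= n%:R -> (2 * m <= n)%N.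
    move=> h; rewrite -(ler_nat R) natrM; apply: le_trans h.
    exact: ler_wpM2r.
  pose b x := (f x + u (f x) l)%N; pose e x := (f x + v (f x) l.+1)%N.
  have facts x : A l x ->
      [/\ f x <= x, x - f x < v (f x) l, 2 * v (f x) l <= u (f x) l,
          2 * u (f x) l <= v (f x) l.+1 & e x <= N]%N.
    move=> Ax; have [pf /andP[fx xf]] := fP x Ax.
    have [/le2 h1 /le2 h2 _ _] := hup _ l pf lr.
    have [_ _ eN] := hv _ l.+1 pf lr.
    by split => //; lia.
  apply: (@growth_step _ theta K N (A l) (A l.+1) b e).
  - exact: ltW.
  - exact: Kth.
  - by move=> x /facts[]; rewrite /b /e => *; split; lia.
  - move=> x Ax; have [fx xf uv vu eN] := facts x Ax; have [pf _] := fP x Ax.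
    have [_ h2 _ _] := hup _ l pf lr.
    rewrite /b /e (_ : f x + u (f x) l - x = u (f x) l - (x - f x))%N; last by lia.
    rewrite (_ : f x + v (f x) l.+1 - x = v (f x) l.+1 - (x - f x))%N; last by lia.
    rewrite (natrB _ (_ : x - f x <= u (f x) l)%N) 1?(natrB _ (_ : x - f x <= v (f x) l.+1)%N);
      try by move: xf uv vu; clear; lia.
    have : (x - f x)%:R <= K * (x - f x)%:R :> R.
      by apply: ler_peMl => //; lra.
    by rewrite mulrBr; lra.
  - move=> x q Ax /andP[xq qe]; have [fx _ _ _ _] := facts x Ax.
    have [pf _] := fP x Ax; apply/asboolP; exists (f x) => //.
    by rewrite qe (leq_trans fx).
  - move=> x Ax; have [fx xf uv vu eN] := facts x Ax; have [pf _] := fP x Ax.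
    have [h1 h2 _ hJ] := hup _ l pf lr.
    have Jfree_e p : (p < e x)%N -> J p (e x) <= 3 + J p.+1 (e x).
      by move=> pe; apply: Jfree; rewrite pe.
    have xe : (x <= e x)%N by rewrite /e; move: fx xf uv vu; clear; lia.
    have fxe : (f x <= x <= e x)%N by rewrite fx.
    have s2 : 0 <= s + 2 * eps by lra.
    have Jfx := free_bound _ _ _ Jfree_e _ _ fxe.
    have fill := @fill_bound _ (s + 2 * eps) (A l) b (e x) (J ^~ (e x)) s2 (J0 _) Jfree_e.
    set cnt := (count_in _ _ _)%:R.
    have {fill} : J x (e x) <= (s + 2 * eps) * (e x - x)%:R + 3 * cnt.
      apply: fill xe => q Aq; have [fq qf uv' vu' _] := facts q Aq.
        by rewrite /b; move: fq qf uv'; clear; lia.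
      move=> bqe; have [pq _] := fP q Aq; have [h1q _ hL _] := hup _ l pq lr.
      have [_ l0v _] := hv _ l pq (ltnW lr).
      have ql0 : (q + l0 <= b q)%N.
        by rewrite /b; move: l0v fq qf uv'; clear; lia.
      have qb : (f q <= q <= b q)%N.
        by rewrite fq; apply: leq_trans ql0; apply: leq_addr.
      have bqeN : (b q <= e x <= N)%N by rewrite bqe.
      apply: le_trans (Jblock q (b q) (e x) ql0 bqeN) _; rewrite lerD2r.
      have Lq := Lmono (f q) q (b q) qb (leq_trans bqe eN).
      have -> : (b q - q = u (f q) l - (q - f q))%N.
        by rewrite /b; move: fq; clear; lia.
      rewrite natrB; last by move: qf uv'; clear; lia.
      have : (s + eps) * (q - f q)%:R <= eps * (u (f q) l)%:R.
        apply: (@le_trans _ _ (eps * (K * (v (f q) l)%:R))); last first.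
          by rewrite ler_pM2l.
        rewrite mulrA [eps * K]mulrC; apply: ler_pM => //; first by lra.
        by rewrite ler_nat ltnW.
      by move: Lq; rewrite {2}/b; lra.
    have K2u : 2 * (u (f x) l)%:R <= (v (f x) l.+1)%:R :> R.
      by rewrite -natrM ler_nat.
    have xfv : (x - f x)%:R <= theta * (v (f x) l.+1)%:R.
      apply: (@le_trans _ _ (theta * (K * (u (f x) l)%:R))); last by rewrite ler_pM2l.
      apply: (@le_trans _ _ (2 * (u (f x) l)%:R)).
        by rewrite -natrM ler_nat; move: xf uv; clear; lia.
      by rewrite mulrA [theta * K]mulrC ler_wpM2r.
    have ev : (e x - x)%:R <= (v (f x) l.+1)%:R :> R by rewrite ler_nat /e; move: fx; clear; lia.
    have := ler_wpM2l s2 ev; have := ler_wpM2l (ltW th0) ev.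
    by move: hJ Jfx; rewrite -/(e x); lra.
have pow l : (l <= r)%N ->
    (1 + theta) ^+ l * (count_in (A 0%N) 0 N)%:R <= (count_in (A l) 0 N)%:R.
  elim: l => [|l IH] lr; first by rewrite expr0 mul1r.
  rewrite exprS -mulrA; apply: le_trans (step l lr).
  by apply: ler_wpM2l; [lra|apply: IH; apply: ltnW].
apply: (@le_trans _ _ (count_in (A r) 0 N)%:R); last first.
  by rewrite ler_nat; have := count_in_le_length (A r) 0 N; lia.
apply: le_trans (pow r (leqnn r)); apply: ler_wpM2l; first by apply: exprn_ge0; lra.
rewrite ler_nat; apply: sub_count_in => a _ /asboolP pa; apply/asboolP.
by exists a => //; have [v0 _ _] := hv a 0%N pa (leq0n r); lia.
Qed.

(** Here f n is the information of the first n letters; its monotonicity gives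
    t (j m) < f (j m) <= f (i m.+1) < s (i m.+1). *)
Lemma upcrossing_lengths (R : realFieldType) (s t : R) (k M : nat)
    (i j : nat -> nat) (f : nat -> R) :
  0 < s -> s < t ->
  (forall m n, (m <= n <= M)%N -> f m <= f n) ->
  (forall m, (m < k)%N -> (i m < j m <= M)%N) ->
  (forall m, (m.+1 < k)%N -> (j m < i m.+1)%N) ->
  (forall m, (m < k)%N -> f (i m) < s * (i m)%:R /\ t * (j m)%:R < f (j m)) ->
  forall m g, (m + g < k)%N ->
    (t / s) ^+ g * (j m)%:R <= (j (m + g)%N)%:R /\
    ((0 < g)%N -> (t / s) ^+ g * (j m)%:R <= (i (m + g)%N)%:R).
Proof.
move=> s0 st fmono ij ji hf m; elim=> [|g IH] mg; first by rewrite addn0 expr0 mul1r.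
have {}IH : (t / s) ^+ g * (j m)%:R <= (j (m + g)%N)%:R by apply: (IH _).1; lia.
suff h : (t / s) ^+ g.+1 * (j m)%:R <= (i (m + g.+1)%N)%:R.
  split=> //; apply: le_trans h _.
  by rewrite ler_nat; have /andP[/ltnW] := ij _ mg.
have ts0 : 0 <= t / s by apply: divr_ge0; lra.
rewrite exprS -mulrA; apply: le_trans (ler_wpM2l ts0 IH) _.
rewrite mulrAC ler_pdivrMr // [leRHS]mulrC addnS.
rewrite addnS in mg.
have /andP[_ jM] := ij _ mg; have /andP[ijS _] := ij _ mg.
have mg' : (m + g < k)%N by lia.
have [_ h1] := hf _ mg'; have [h2 _] := hf _ mg.
apply/ltW; apply: (lt_trans h1); apply: le_lt_trans h2.
by apply: fmono; have := ji _ mg; lia.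
Qed.

(** * Sums over words and stationary laws on words *)

Section WordSums.
Variable R : realType.
Implicit Types (F G : seq bool -> R).

Lemma sum_words0 F : \sum_(w : 0.-tuple bool) F w = F [::].
Proof.
rewrite (bigD1 [tuple]) //= big1 ?addr0 // => w /eqP[].
exact: tuple0.
Qed.

Lemma sum_wordsS n F :
  \sum_(w : n.+1.-tuple bool) F w =
  \sum_(w : n.-tuple bool) F (true :: w) + \sum_(w : n.-tuple bool) F (false :: w).
Proof.
rewrite (reindex (fun p : bool * n.-tuple bool => cons_tuple p.1 p.2)) /=.
  rewrite -(pair_bigA _ (fun b (w : n.-tuple bool) => F (b :: w))) /=.
  by rewrite big_bool.
exists (fun w : n.+1.-tuple bool => (thead w, behead_tuple w)).
  by case=> b w _ /=; congr pair; apply: val_inj.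
by move=> w _; rewrite /= [RHS]tuple_eta; apply: val_inj.
Qed.

Lemma sum_words_cat m n F :
  \sum_(w : (m + n).-tuple bool) F w =
  \sum_(u : m.-tuple bool) \sum_(v : n.-tuple bool) F (u ++ v).
Proof.
elim: m F => [|m IH] F.
  by rewrite (sum_words0 (fun u => \sum_(v : n.-tuple bool) F (u ++ v))).
rewrite [LHS](sum_wordsS (m + n)).
rewrite (IH (fun w => F (true :: w))) (IH (fun w => F (false :: w))).
by rewrite (sum_wordsS _ (fun u => \sum_(v : n.-tuple bool) F (u ++ v))).
Qed.

End WordSums.

(** The finite-dimensional distributions of a stationary binary process:
    law_rcons is consistency and law_cons is invariance under the shift. *)
Record word_law (R : realType) (mu : seq bool -> R) : Prop := WordLaw {
  law_ge0 : forall w, 0 <= mu w;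
  law_nil : mu [::] = 1;
  law_cons : forall w, mu (true :: w) + mu (false :: w) = mu w;
  law_rcons : forall w, mu (rcons w true) + mu (rcons w false) = mu w }.

Section WordLaws.
Variables (R : realType) (mu : seq bool -> R).
Hypothesis mu_law : word_law R mu.

Lemma law_sum_suffix u n : \sum_(v : n.-tuple bool) mu (u ++ v) = mu u.
Proof.
elim: n u => [|n IH] u; first by rewrite (sum_words0 _ (fun v => mu (u ++ v))) cats0.
rewrite (sum_wordsS _ n (fun v => mu (u ++ v))) -[RHS](law_rcons _ _ mu_law).
rewrite -!IH; congr (_ + _); apply: eq_bigr => v _; by rewrite cat_rcons.
Qed.

Lemma law_sum_prefix u n : \sum_(v : n.-tuple bool) mu (v ++ u) = mu u.
Proof.
elim: n => [|n IH]; first by rewrite (sum_words0 _ (fun v => mu (v ++ u))).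
rewrite (sum_wordsS _ n (fun v => mu (v ++ u))) -big_split -[RHS]IH /=.
by apply: eq_bigr => v _; rewrite (law_cons _ _ mu_law).
Qed.

Lemma law_sum1 n : \sum_(v : n.-tuple bool) mu v = 1.
Proof. by rewrite (law_sum_suffix [::]) (law_nil _ _ mu_law). Qed.

Lemma law_le_suffix u v : mu (u ++ v) <= mu v.
Proof.
elim: u => //= b u IH; apply: le_trans IH.
rewrite -(law_cons _ _ mu_law (u ++ v)).
by have := law_ge0 _ _ mu_law; case: b => h; rewrite ?lerDl ?lerDr.
Qed.

Lemma law_le_prefix u v : mu (u ++ v) <= mu u.
Proof.
elim/last_ind: v => [|v b IH]; first by rewrite cats0.
apply: le_trans IH; rewrite -rcons_cat -(law_rcons _ _ mu_law (u ++ v)).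
by have := law_ge0 _ _ mu_law; case: b => h; rewrite ?lerDl ?lerDr.
Qed.

(** Stationarity and consistency in the form in which they are used: a block at
    any position in a long word has the law mu. *)
Lemma law_sum_factor i m n (F : seq bool -> R) : (i + m <= n)%N ->
  \sum_(x : n.-tuple bool) mu x * F (take m (drop i x)) =
  \sum_(w : m.-tuple bool) mu w * F w.
Proof.
move=> imn; have -> : n = (i + (m + (n - (i + m))))%N by lia.
set r := (n - _)%N.
rewrite (sum_words_cat _ i (m + r) (fun x => mu x * F (take m (drop i x)))) exchange_big /=.
transitivity (\sum_(y : (m + r).-tuple bool) mu y * F (take m y)).
  apply: eq_bigr => y _; rewrite -[in RHS](law_sum_prefix y i) big_distrl /=.
  by apply: eq_bigr => u _; rewrite drop_size_cat ?size_tuple.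
rewrite (sum_words_cat _ m r (fun y => mu y * F (take m y))).
apply: eq_bigr => v _; rewrite -[in RHS](law_sum_suffix v r) big_distrl /=.
by apply: eq_bigr => z _; rewrite take_size_cat ?size_tuple.
Qed.

End WordLaws.

(** * A code that exploits blocks of small information *)

(** The sum, over all ways to cut w into single letters and blocks of length at
    least l0, of the product of exp (-3) for each letter and of q ^ l * mu (u)
    for each block u of length l.  The number f only bounds the recursion; it
    is large enough as soon as it is at least the length of w. *)
Fixpoint parse_weight (R : realType) (mu : seq bool -> R) (q : R) (l0 f : nat)
    (w : seq bool) : R :=
  match w, f with
  | [::], _ => 1
  | _ :: _, 0%N => 0
  | _ :: w', f'.+1 =>
      expR (-3) * parse_weight R mu q l0 f' w' +
      \sum_(l0 <= l < (size w).+1)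
        q ^+ l * mu (take l w) * parse_weight R mu q l0 f' (drop l w)
  end.

Section CodeWeight.
Variables (R : realType) (mu : seq bool -> R) (q : R) (l0 : nat).
Hypotheses (mu_law : word_law R mu) (q_ge0 : 0 <= q).
Local Notation pw := (parse_weight R mu q l0).

Definition code_weight (w : seq bool) : R := pw (size w) w.

Lemma parse_weight_ge0 f w : 0 <= pw f w.
Proof.
elim: f w => [|f IH] [|b w] //=.
rewrite addr_ge0 ?mulr_ge0 ?expR_ge0 // sumr_ge0 // => l _.
by rewrite !mulr_ge0 ?exprn_ge0 //; apply: (law_ge0 _ _ mu_law).
Qed.

Lemma parse_weight_fuel f f' w : (f <= f')%N -> pw f w <= pw f' w.
Proof.
elim: f f' w => [|f IH] [|f'] [|b w] //= ff'.
  rewrite addr_ge0 ?mulr_ge0 ?expR_ge0 ?parse_weight_ge0 // sumr_ge0 // => l _.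
  by rewrite !mulr_ge0 ?exprn_ge0 ?parse_weight_ge0 //; apply: (law_ge0 _ _ mu_law).
apply: lerD; first by rewrite ler_wpM2l ?expR_ge0 ?IH.
apply: ler_sum => l _; apply: ler_wpM2l; last exact: IH.
by rewrite mulr_ge0 ?exprn_ge0 //; apply: (law_ge0 _ _ mu_law).
Qed.

Lemma code_weight_cons b w : expR (-3) * code_weight w <= code_weight (b :: w).
Proof.
rewrite /code_weight /= lerDl sumr_ge0 // => l _.
by rewrite !mulr_ge0 ?exprn_ge0 ?parse_weight_ge0 //; apply: (law_ge0 _ _ mu_law).
Qed.

Lemma code_weight_cat u v : (0 < l0 <= size u)%N ->
  q ^+ size u * mu u * code_weight v <= code_weight (u ++ v).
Proof.
case: u => [|b u]; first by case: l0.
move=> /andP[l0_gt0 l0u]; rewrite /code_weight [X in _ <= X]/=.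
rewrite (bigD1_seq (size u).+1) ?iota_uniq //=; last first.
  by rewrite mem_index_iota size_cat; move: l0u => /=; lia.
rewrite take_size_cat // drop_size_cat //.
apply: (@le_trans _ _ (q ^+ (size u).+1 * mu (b :: u) * pw (size (u ++ v)) v)).
  apply: ler_wpM2l.
    by rewrite mulr_ge0 ?exprn_ge0 //; apply: (law_ge0 _ _ mu_law).
  by apply: parse_weight_fuel; rewrite size_cat leq_addl.
rewrite addrCA lerDl addr_ge0 ?mulr_ge0 ?expR_ge0 ?parse_weight_ge0 // sumr_ge0 // => l _.
by rewrite !mulr_ge0 ?exprn_ge0 ?parse_weight_ge0 //; apply: (law_ge0 _ _ mu_law).
Qed.

Lemma code_weight_gt0 w : 0 < code_weight w.
Proof.
elim: w => [|b w IH]; first by rewrite /code_weight /= ltr01.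
by apply: lt_le_trans (code_weight_cons b w); rewrite mulr_gt0 ?expR_gt0.
Qed.

(** By the first piece of the parsing: a letter contributes 2 exp (-3) <= 1/2,
    and a block of length l contributes q ^ l because mu has total mass 1. *)
Lemma sum_parse_weight_le1 :
  (forall n, \sum_(l0 <= l < n) q ^+ l <= 2^-1) ->
  forall f n, \sum_(w : n.-tuple bool) pw f w <= 1.
Proof.
move=> geo; elim=> [|f IH] [|n].
- by rewrite (sum_words0 _ (pw 0)).
- by rewrite (sum_wordsS _ n (pw 0)) /= !big1 // addr0 ler01.
- by rewrite (sum_words0 _ (pw f.+1)).
pose G w := expR (-3) * pw f (behead w) +
  \sum_(l0 <= l < n.+2) q ^+ l * mu (take l w) * pw f (drop l w).
rewrite (eq_bigr (fun w : n.+1.-tuple bool => G w)); last first.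
  by move=> [[|b w] //= /eqP] [sw] _; rewrite /G /= sw.
rewrite big_split /= (sum_wordsS _ n (fun w => expR (-3) * pw f (behead w))) /=.
rewrite -!mulr_sumr exchange_big /=.
have free : expR (-3) * \sum_(w : n.-tuple bool) pw f w <= 4^-1.
  apply: (@le_trans _ _ (expR (-3) * 1)); first by rewrite ler_wpM2l ?expR_ge0.
  rewrite mulr1 expRN lef_pV2 ?posrE ?expR_gt0 //.
  by apply: le_trans (expR_ge1Dx _); lra.
have blocks : \sum_(l0 <= l < n.+2) \sum_(w : n.+1.-tuple bool)
    q ^+ l * mu (take l w) * pw f (drop l w) <= 2^-1.
  apply: le_trans (geo n.+2); rewrite big_nat_cond [leRHS]big_nat_cond.
  apply: ler_sum => l /andP[/andP[_ ln] _].
  have -> : n.+1 = (l + (n.+1 - l))%N by lia.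
  set m := (n.+1 - l)%N.
  rewrite (sum_words_cat _ l m (fun w => q ^+ l * mu (take l w) * pw f (drop l w))).
  apply: (@le_trans _ _ (\sum_(u : l.-tuple bool) q ^+ l * mu u)); last first.
    by rewrite -mulr_sumr (law_sum1 _ _ mu_law) mulr1.
  apply: ler_sum => u _.
  rewrite (eq_bigr (fun v : m.-tuple bool => q ^+ l * mu u * pw f v)); last first.
    by move=> v _; rewrite take_size_cat ?drop_size_cat ?size_tuple.
  rewrite -mulr_sumr; apply: ler_piMr; last exact: IH.
  by rewrite mulr_ge0 ?exprn_ge0 //; apply: (law_ge0 _ _ mu_law).
lra.
Qed.

Lemma sum_code_weight_le1 :
  (forall n, \sum_(l0 <= l < n) q ^+ l <= 2^-1) ->
  forall n, \sum_(w : n.-tuple bool) code_weight w <= 1.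
Proof.
move=> geo n; apply: le_trans (sum_parse_weight_le1 geo n n).
by apply: ler_sum => w _; rewrite /code_weight size_tuple.
Qed.

Definition compressible (t tau : R) (w : seq bool) : bool :=
  (t * (size w)%:R < - ln (mu w)) && (- ln (code_weight w) < tau * (size w)%:R).

(** On a compressible word mu <= exp (- (t - tau) n) * code_weight, and the code
    weights have total mass at most 1. *)
Lemma compressible_prob t tau n :
  (forall n, \sum_(l0 <= l < n) q ^+ l <= 2^-1) ->
  \sum_(w : n.-tuple bool) mu w * (compressible t tau w)%:R
    <= expR (- (t - tau)) ^+ n.
Proof.
move=> geo; set e := expR _ ^+ n.
apply: (@le_trans _ _ (\sum_(w : n.-tuple bool) e * code_weight w)); last first.
  rewrite -mulr_sumr; apply: ler_piMr; first exact/exprn_ge0/expR_ge0.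
  exact: sum_code_weight_le1.
apply: ler_sum => w _.
have cw := code_weight_gt0 w.
have e0 : 0 <= e by apply/exprn_ge0/expR_ge0.
rewrite /compressible size_tuple; case: andP => [[h1 h2]|_]; last first.
  by rewrite mulr0 mulr_ge0 // ltW.
rewrite mulr1.
have := law_ge0 _ _ mu_law w; rewrite le_eqVlt => /predU1P[<-|mw].
  by rewrite mulr_ge0 // ltW.
rewrite -[mu w]lnK ?posrE // -[code_weight w]lnK ?posrE //.
by rewrite /e -expRM_natl -expRD ler_expR; lra.
Qed.

Lemma compressible_prefix_prob t tau m M :
  (forall n, \sum_(l0 <= l < n) q ^+ l <= 2^-1) -> tau < t ->
  \sum_(w : M.-tuple bool)
      mu w * (`[< exists2 n, (m <= n <= M)%N & compressible t tau (take n w) >])%:R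
    <= expR (- (t - tau)) ^+ m / (1 - expR (- (t - tau))).
Proof.
move=> geo tt; set e := expR _.
have e01 : 0 <= e < 1 by rewrite expR_ge0 expR_lt1 oppr_lt0 subr_gt0.
apply: le_trans (geometric_tail_le _ e m M.+1 e01).
apply: (@le_trans _ _ (\sum_(m <= n < M.+1) \sum_(w : M.-tuple bool)
    mu w * (compressible t tau (take n w))%:R)).
  rewrite exchange_big /=; apply: ler_sum => w _; rewrite -mulr_sumr.
  apply: ler_wpM2l; first exact: (law_ge0 _ _ mu_law).
  case: asboolP => [[n nM cn]|_]; last exact: sumr_ge0.
  rewrite (bigD1_seq n) ?iota_uniq ?mem_index_iota //= cn lerDl.
  exact: sumr_ge0.
rewrite big_nat_cond [leRHS]big_nat_cond; apply: ler_sum => n /andP[/andP[_ nM] _].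
apply: le_trans (compressible_prob t tau n geo).
rewrite -(law_sum_factor _ _ mu_law 0 n M (fun w => (compressible t tau w)%:R)) //.
by apply: ler_sum => w _; rewrite drop0.
Qed.

End CodeWeight.

(** * Density of upcrossings in a finite window *)

Definition segment (p q : nat) (x : seq bool) : seq bool := take (q - p) (drop p x).

Lemma segment_cat p m q x : (p <= m <= q)%N ->
  segment p q x = segment p m x ++ segment m q x.
Proof.
move=> /andP[pm mq]; rewrite /segment.
rewrite (_ : q - p = (m - p) + (q - m))%N; last by lia.
by rewrite takeD drop_drop (_ : m - p + p = m)%N //; lia.
Qed.

Lemma size_segment p q x : (p <= q <= size x)%N -> size (segment p q x) = (q - p)%N.
Proof. by move=> pqx; rewrite size_takel // size_drop; lia. Qed.

Lemma segment_cons p q x : (p < q <= size x)%N ->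
  exists b, segment p q x = b :: segment p.+1 q x.
Proof.
move=> pqx; rewrite (segment_cat p p.+1 q); last by lia.
have := size_segment p p.+1 x; rewrite subSnn.
case: (segment p p.+1 x) => [|b [|c s]] // h.
- by have : 0%N = 1%N by apply: h; lia.
- by exists b.
by have : (size s).+2 = 1%N by apply: h; lia.
Qed.

(** Upcrossings of the information rate that occur up to time M; the witnesses i
    and j are kept as arguments because the growth of their values is needed. *)
Definition upcrossings_within (R : realType) (mu : seq bool -> R) (k M : nat)
    (s t : R) (w : seq bool) (i j : nat -> nat) : Prop :=
  [/\ forall m, (m < k)%N -> (1 <= i m < j m)%N /\ (j m <= M)%N,
      forall m, (m.+1 < k)%N -> (j m < i m.+1)%N &
      forall m, (m < k)%N -> - ln (mu (take (i m) w)) < s * (i m)%:R /\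
                             t * (j m)%:R < - ln (mu (take (j m) w))].

Lemma upcrossings_take (R : realType) (mu : seq bool -> R) k M s t w i j :
  upcrossings_within R mu k M s t (take M w) i j ->
  upcrossings_within R mu k M s t w i j.
Proof.
move=> [h1 h2 h3]; split=> // m mk; have [/andP[_ ij] jM] := h1 m mk.
by have := h3 m mk; rewrite !take_takel // ltnW // (leq_trans ij).
Qed.

Section Window.
Variables (R : realType) (mu : seq bool -> R) (s t : R) (l0 g r k M : nat).
Hypotheses (mu_law : word_law R mu) (s_gt0 : 0 < s) (st : s < t).
(* The three rates s + 2 eps < tau < t are spaced so that tau - (s + 2 eps) =
   12 theta and t - tau = eps; K is the growth of the block lengths over g
   upcrossings. *)
Let eps := (t - s) / 4.
Let theta := (t - s) / 48.
Let K := (t / s) ^+ g.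
Let q := expR (- eps).
Let tau := s + 2 * eps + 12 * theta.
Hypotheses (l0_gt0 : (0 < l0)%N)
  (geo : forall n, \sum_(l0 <= l < n) q ^+ l <= 2^-1).
Hypotheses (g_gt0 : (0 < g)%N) (K2 : 2 <= K) (Kth : 2 <= K * theta)
  (Keps : s + eps <= K * eps).
Hypotheses (l0r : (l0 <= r)%N) (rk : (r + 2 * g * r < k)%N).

Definition typical_upcrossings (w : seq bool) : Prop :=
  (exists i j, upcrossings_within R mu k M s t w i j) /\
  ~ (exists2 n, (r <= n <= M)%N & compressible R mu q l0 t tau (take n w)).

(** In a word of length 2 M and positive probability, all blocks have positive
    probability, so information and code length are finite and monotone.  The
    first r upcrossings are skipped, which makes all lengths exceed r >= l0;
    after that every 2 g-th j serves as v, and the i halfway in between as u. *)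
Lemma typical_density (x : seq bool) : size x = (2 * M)%N -> 0 < mu x ->
  (1 + theta) ^+ r *
    (\sum_(a < M) (`[< typical_upcrossings (take M (drop a x)) >])%:R) <= (2 * M)%:R.
Proof.
move=> sx mux.
pose pts a := (a < M)%N /\ typical_upcrossings (take M (drop a x)).
have [f fP] : {f : nat -> (nat -> nat) * (nat -> nat) & forall a, pts a ->
    upcrossings_within R mu k M s t (drop a x) (f a).1 (f a).2}.
  apply: (@choice _ _ (fun a ij => pts a ->
    upcrossings_within R mu k M s t (drop a x) ij.1 ij.2)) => a.
  have [[_ [[i [j ij]] _]]|na] := pselect (pts a); last by exists (id, id).
  by exists (i, j) => _; apply: upcrossings_take.
pose v a l := (f a).2 (r + 2 * g * l)%N.
pose u a l := (f a).1 (r + 2 * g * l + g)%N.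
pose L p m := - ln (mu (segment p m x)).
pose J p m := - ln (code_weight R mu q l0 (segment p m x)).
have mu_seg p m : (p <= m)%N -> 0 < mu (segment p m x).
  move=> pm; apply: (lt_le_trans mux).
  rewrite -[x in mu x](cat_take_drop p) -[drop p x](cat_take_drop (m - p)).
  apply: le_trans (law_le_suffix _ _ mu_law _ _) _.
  exact: (law_le_prefix _ _ mu_law).
have LE a n : L a (a + n)%N = - ln (mu (take n (drop a x))).
  by rewrite /L /segment addKn.
have Lpre a m n : (m <= n)%N -> L a (a + m)%N <= L a (a + n)%N.
  move=> mn; rewrite lerN2 ler_ln ?posrE ?mu_seg ?leq_addr //.
  rewrite (segment_cat a (a + m)%N (a + n)%N) ?leq_addr ?leq_add2l //.
  exact: (law_le_prefix _ _ mu_law).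
have jgt a m : pts a -> (m < k)%N -> (m < (f a).2 m)%N.
  move=> /fP[h1 h2 _]; elim: m => [|m IH] mk; first by have [/andP[]] := h1 _ mk; lia.
  by have := IH (ltnW mk); have := h2 m mk; have [/andP[]] := h1 _ mk; lia.
have lens a := @upcrossing_lengths _ s t k M (f a).1 (f a).2 (fun n => L a (a + n)%N) s_gt0 st.
have idx l : (l <= r)%N -> (2 * g * l <= 2 * g * r)%N by move=> lr; rewrite leq_mul2l lr orbT.
have idxS l : (l < r)%N -> (2 * g * l + 2 * g <= 2 * g * r)%N.
  by move=> lr; rewrite -mulnSr leq_mul2l lr orbT.
have := @alternation_density R s eps theta K (2 * M) l0 r L J pts u v.
have e0 : 0 < eps by rewrite divr_gt0 ?subr_gt0.
have th0 : 0 < theta by rewrite divr_gt0 ?subr_gt0.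
move=> dens; apply: le_trans (dens _ e0 th0 K2 Kth Keps _ _ _ _ _ _) => {dens}.
- apply: ler_wpM2l; first by apply: exprn_ge0; lra.
  rewrite -natr_sum ler_nat -(big_mkord predT (fun a =>
    nat_of_bool `[< typical_upcrossings (take M (drop a x)) >])).
  rewrite (count_in_cat _ 0 M); last by lia.
  apply: leq_trans (leq_addr _ _); rewrite /count_in big_nat_cond [in leqRHS]big_nat_cond.
  apply: leq_sum => a /andP[/andP[_ aM] _].
  by case: asboolP => // h; case: asboolP => // [[]].
- exact: ltW.
- move=> p p' m /andP[pp' p'm] mN.
  rewrite lerN2 ler_ln ?posrE ?mu_seg // ?(leq_trans pp') //.
  rewrite (segment_cat p p' m) ?pp' //; exact: (law_le_suffix _ _ mu_law).
- by move=> m; rewrite /J /segment subnn take0 /code_weight /= ln1 oppr0.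
- move=> p m; rewrite -sx => pm; have q0 : 0 <= q by apply: expR_ge0.
  have [b eb] := segment_cons p m x pm.
  rewrite /J eb lerNl opprD opprK -[- 3]expRK -lnM ?posrE ?expR_gt0 //; last first.
    exact: (code_weight_gt0 _ _ _ _ mu_law q0).
  rewrite ler_ln ?posrE ?mulr_gt0 ?expR_gt0 ?code_weight_gt0 ?expR_ge0 //.
  by apply: code_weight_cons; rewrite ?expR_ge0.
- move=> p m n pm /andP[mn nN]; have q0 : 0 <= q by apply: expR_ge0.
  have pm' : (p <= m)%N by apply: leq_trans pm; apply: leq_addr.
  have spm : size (segment p m x) = (m - p)%N.
    by rewrite size_segment // pm' sx (leq_trans mn).
  have := @code_weight_cat R mu q l0 mu_law q0 (segment p m x) (segment m n x).
  rewrite spm l0_gt0 leq_subRL // pm -segment_cat ?pm' // => /(_ isT) cat.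
  have c1 := code_weight_gt0 _ _ _ l0 mu_law q0 (segment m n x).
  have c2 := code_weight_gt0 _ _ _ l0 mu_law q0 (segment p n x).
  have m1 := mu_seg p m pm'.
  have qn : 0 < q ^+ (m - p) by apply/exprn_gt0/expR_gt0.
  rewrite /J /L.
  have -> : eps * (m - p)%:R = - ln (q ^+ (m - p)).
    by rewrite /q -expRM_natl expRK mulrN opprK mulrC.
  rewrite addrC -!opprD lerN2.
  move: cat; rewrite -ler_ln ?posrE ?mulr_gt0 // !lnM ?posrE ?mulr_gt0 //.
  lra.
- move=> a l pa lr; have [h1 _ _] := fP a pa; have [aM _] := pa.
  have mk : (r + 2 * g * l < k)%N.
    by apply: leq_ltn_trans rk; rewrite leq_add2l idx.
  have [_ jM] := h1 _ mk; have := jgt a _ pa mk.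
  by rewrite -/(v a l) in jM *; move: jM aM l0r; clear; split; lia.
- move=> a l pa lr; have [h1 h2 h3] := fP a pa; have [aM [_ nc]] := pa.
  have {lens} lens := lens a.
  have mono m n : (m <= n <= M)%N -> L a (a + m)%N <= L a (a + n)%N.
    by move=> /andP[mn _]; apply: Lpre.
  have {lens mono} lens := lens mono.
  have h1' m : (m < k)%N -> ((f a).1 m < (f a).2 m <= M)%N.
    by move=> /h1[/andP[_ ->] ->].
  have h3' m : (m < k)%N -> L a (a + (f a).1 m)%N < s * ((f a).1 m)%:R /\
      t * ((f a).2 m)%:R < L a (a + (f a).2 m)%N.
    by rewrite !LE; apply: h3.
  have {lens} lens := lens h1' h2 h3'.
  have mk : (r + 2 * g * l + g + g < k)%N.
    by apply: leq_ltn_trans rk; have := idxS l lr; clear; lia.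
  have mk' : (r + 2 * g * l + g < k)%N by apply: leq_ltn_trans mk; apply: leq_addr.
  have [_ /(_ g_gt0) l1] := lens _ _ mk'.
  have [l2 _] := lens _ _ mk.
  have vE : (v a l.+1 = (f a).2 (r + 2 * g * l + g + g))%N.
    by rewrite /v; congr ((f a).2 _); clear; lia.
  split=> //.
  + rewrite vE; apply: le_trans l2; apply: ler_wpM2l; first exact: le_trans (ler0n _ 2) K2.
    by rewrite ler_nat; have /andP[/ltnW] := h1' _ mk'.
  + by have [/ltW] := h3' _ mk'.
  + have [_ ht] := h3' _ mk; have /andP[_ jM] := h1' _ mk.
    rewrite vE; set n := (f a).2 _ in ht jM *.
    have nr : (r <= n)%N.
      by apply: ltnW; apply: leq_ltn_trans (jgt a _ pa mk); clear; lia.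
    rewrite leNgt; apply/negP => hJ; apply: nc; exists n; first by rewrite nr.
    have sn : size (take n (drop a x)) = n.
      by rewrite size_takel // size_drop sx; move: jM aM; clear; lia.
    rewrite /compressible take_takel // sn -LE ht /=.
    by move: hJ; rewrite /J /segment addKn.
Qed.

(** Average the density bound over the window of length 2 M: each of the M
    starting points sees a block of length M with the law mu. *)
Lemma typical_prob : (0 < M)%N ->
  \sum_(w : M.-tuple bool) mu w * (`[< typical_upcrossings w >])%:R
    <= 2 / (1 + theta) ^+ r.
Proof.
move=> M0; set S := \sum_(w : _) _.
have th0 : 0 < theta by rewrite divr_gt0 ?subr_gt0.
have pow0 : 0 < (1 + theta) ^+ r by apply: exprn_gt0; lra.
rewrite ler_pdivlMr //.
have M0' : 0 < M%:R :> R by rewrite ltr0n.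
rewrite -(ler_pM2l M0') mulrA.
pose F (a : nat) (x : seq bool) : R := (`[< typical_upcrossings (take M (drop a x)) >])%:R.
have -> : M%:R * S = \sum_(x : (2 * M).-tuple bool) mu x * \sum_(a < M) F a x.
  transitivity (\sum_(a < M) \sum_(x : (2 * M).-tuple bool) mu x * F a x).
    rewrite (eq_bigr (fun=> S)) ?sumr_const ?card_ord ?mulr_natl // => a _.
    have aM : (a + M <= 2 * M)%N by have := ltn_ord a; lia.
    exact: (law_sum_factor _ _ mu_law a M (2 * M)
      (fun w => (`[< typical_upcrossings w >])%:R) aM).
  by rewrite exchange_big /=; apply: eq_bigr => x _; rewrite mulr_sumr.
rewrite big_distrl /=.
apply: (@le_trans _ _ (\sum_(x : (2 * M).-tuple bool) mu x * (2 * M)%:R)); last first.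
  by rewrite -big_distrl /= (law_sum1 _ _ mu_law) mul1r natrM mulrC.
apply: ler_sum => x _; rewrite -mulrA.
have := law_ge0 _ _ mu_law x; rewrite le_eqVlt => /predU1P[<-|mux].
  by rewrite !mul0r.
by rewrite ler_pM2l // mulrC typical_density ?size_tuple.
Qed.

Lemma upcrossings_within_prob :
  \sum_(w : M.-tuple bool)
      mu w * (`[< exists i j, upcrossings_within R mu k M s t w i j >])%:R
    <= 2 / (1 + theta) ^+ r + expR (- eps) ^+ r / (1 - expR (- eps)).
Proof.
have eps0 : 0 < eps by rewrite divr_gt0 ?subr_gt0.
have th0 : 0 < theta by rewrite divr_gt0 ?subr_gt0.
have e1 : expR (- eps) < 1 by rewrite expR_lt1 oppr_lt0.
have [M0|M0] := posnP M.
  rewrite big1 => [|w _].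
    apply: addr_ge0; apply: divr_ge0 => //; try exact/exprn_ge0/expR_ge0.
      by apply: exprn_ge0; lra.
    by rewrite subr_ge0 ltW.
  case: asboolP => [[i [j [h _ _]]]|_]; last by rewrite mulr0.
  have k0 : (0 < k)%N by apply: leq_ltn_trans rk.
  have [/andP[i1 ij] jM] := h 0%N k0; exfalso; suff : (0 < M)%N by rewrite M0.
  by apply: leq_trans jM; apply: leq_ltn_trans ij.
have tau_t : t - tau = eps by rewrite /tau /eps /theta; field.
have tau_lt : tau < t by rewrite -subr_gt0 tau_t.
have := compressible_prefix_prob R mu q l0 mu_law (expR_ge0 _) t tau r M geo tau_lt.
rewrite tau_t; move/(lerD (typical_prob M0)); apply: le_trans.
rewrite -big_split /=; apply: ler_sum => w _; rewrite -mulrDr.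
apply: ler_wpM2l; first exact: (law_ge0 _ _ mu_law).
case: asboolP => [up|_]; last by rewrite addr_ge0.
case: (asboolP (exists2 n, _ & _)) => [_|nc]; first by rewrite lerDr.
by case: asboolP => [_|[]]; [rewrite lerDl|split].
Qed.

End Window.

(** * Choice of the constants *)

Lemma expr_small (R : realType) (q e : R) : 0 < q < 1 -> 0 < e ->
  exists n : nat, q ^+ n <= e.
Proof.
move=> /andP[q0 q1] e0.
have [|n hn] := expr_unbounded _ q^-1 e^-1; first by rewrite invf_gt1.
by exists n; rewrite exprVn lef_pV2 ?posrE ?exprn_gt0 // in hn.
Qed.

(** The number of steps r is about k / d, so a bound q ^ r has to be turned into
    a bound rho ^ k.  Bernoulli's inequality provides rho without roots. *)
Lemma slow_rate (R : realFieldType) (q : R) (d : nat) : 0 < q < 1 -> (0 < d)%N ->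
  exists2 rho : R, 0 < rho < 1 & q <= rho ^+ d.
Proof.
move=> /andP[q0 q1] d0; have d0' : 0 < d%:R :> R by rewrite ltr0n.
have x0 : 0 < (1 - q) / d%:R by rewrite divr_gt0 // subr_gt0.
have x1 : (1 - q) / d%:R < 1.
  rewrite ltr_pdivrMr // mul1r; apply: (@lt_le_trans _ _ 1); first by lra.
  by rewrite ler1n.
exists (1 - (1 - q) / d%:R); first by apply/andP; split; lra.
apply: le_trans (bernoulli_ge _ _ _ _); last by lra.
by rewrite mulrN mulrC divfK ?lt0r_neq0 //; lra.
Qed.

(** The constants depend on s and t alone.  For s <= 0 there is no upcrossing on
    a word of positive probability, as the information is nonnegative. *)
Lemma upcrossings_within_decay (R : realType) (s t : R) : s < t ->
  exists c rho : R, [/\ 0 <= c, 0 < rho < 1 &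
    forall (mu : seq bool -> R), word_law R mu -> forall k M : nat, (0 < k)%N ->
      \sum_(w : M.-tuple bool)
         mu w * (`[< exists i j, upcrossings_within R mu k M s t w i j >])%:R
      <= c * rho ^+ k].
Proof.
move=> st; have [s0|s0] := leP s 0.
  exists 0, 2^-1; split; rewrite ?lexx //; first by apply/andP; split; lra.
  move=> mu mu_law k M k0; rewrite mul0r big1 // => w _.
  have := law_ge0 _ _ mu_law w; rewrite le_eqVlt => /predU1P[<-|mw].
    by rewrite mul0r.
  case: asboolP => [[i [j [_ _ /(_ 0%N k0)[h _]]]]|_]; last by rewrite mulr0.
  exfalso; move: h; apply/negP; rewrite -leNgt.
  apply: (@le_trans _ _ 0); first by apply: mulr_le0_ge0.
  rewrite oppr_ge0; apply: ln_le0; rewrite -(law_nil _ _ mu_law).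
  by rewrite -[X in mu X <= _]cat0s; apply: (law_le_prefix _ _ mu_law [::]).
pose eps := (t - s) / 4; pose theta := (t - s) / 48.
have eps0 : 0 < eps by rewrite divr_gt0 ?subr_gt0.
have th0 : 0 < theta by rewrite divr_gt0 ?subr_gt0.
pose q := expR (- eps).
have q01 : 0 < q < 1 by rewrite expR_gt0 expR_lt1 oppr_lt0.
have q1 : 0 < 1 - q by lra.
(* l0 is so large that blocks of length at least l0 have code mass at most 1/2. *)
have [l lq] := expr_small _ q ((1 - q) / 2) q01 (divr_gt0 q1 (ltr0Sn _ 1)).
pose l0 := l.+1.
have geo n : \sum_(l0 <= m < n) q ^+ m <= 2^-1.
  apply: le_trans (geometric_tail_le _ q l0 n _) _; first by lra.
  rewrite ler_pdivrMr // mulrC; apply: le_trans lq.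
  by apply: ler_wiXn2l (leqnSn l); lra.
have ts : 1 < t / s by rewrite ltr_pdivlMr // mul1r.
have [g0 hg0] := expr_unbounded _ (t / s) (2 + 2 / theta + (s + eps) / eps) ts.
pose g := g0.+1; pose K := (t / s) ^+ g.
have [p1 p2] : 0 < 2 / theta /\ 0 < (s + eps) / eps.
  by split; apply: divr_gt0; lra.
have hK : 2 + 2 / theta + (s + eps) / eps <= K.
  by apply: le_trans hg0 _; apply: ler_weXn2l => //; lra.
have K2 : 2 <= K by lra.
have Kth : 2 <= K * theta by rewrite -ler_pdivrMr //; lra.
have Keps : s + eps <= K * eps by rewrite -ler_pdivrMr //; lra.
pose d := (2 * g).+1.
pose q0 := Num.max (1 + theta)^-1 q.
have q00 : 0 < q0 by rewrite lt_max; case/andP: q01 => ->; rewrite orbT.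
have q001 : 0 < q0 < 1.
  by rewrite q00 gt_max invf_lt1 ?ltrDl ?th0; lra.
have [rho rho01 hrho] := slow_rate _ q0 d q001 (ltn0Sn _).
pose C := 2 + (1 - q)^-1 + (q0 ^+ l0)^-1.
have C0 : 0 <= C.
  have i1 : 0 < (q0 ^+ l0)^-1 by rewrite invr_gt0 exprn_gt0.
  have i2 : 0 < (1 - q)^-1 by rewrite invr_gt0.
  by rewrite /C; lra.
exists (C / q0), rho; split => //; first by rewrite divr_ge0 // ltW.
move=> mu mu_law k M k0; set S := \sum_(w : _) _.
pose r := (k.-1 %/ d)%N.
have rk : (r + 2 * g * r < k)%N.
  rewrite -mulSn mulnC -/d; have := leq_trunc_div k.-1 d.
  by rewrite -/r; move: k0; clear; lia.
have kr : (k <= d * r.+1)%N.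
  by rewrite mulnC; have := ltn_ceil k.-1 (ltn0Sn (2 * g)); rewrite -/d -/r; move: k0; clear; lia.
have SC : S <= C * q0 ^+ r.
  have qr0 : 0 < q0 ^+ r by apply: exprn_gt0.
  have i1 : 0 < (1 - q)^-1 by rewrite invr_gt0.
  have i2 : 0 < (q0 ^+ l0)^-1 by rewrite invr_gt0 exprn_gt0.
  (* For r < l0 the bound holds because the total mass is 1. *)
  have [rl|lr] := ltnP r l0.
    apply: (@le_trans _ _ 1).
      rewrite -(law_sum1 _ _ mu_law M); apply: ler_sum => w _.
      by rewrite ler_piMr ?(law_ge0 _ _ mu_law) // lern1 leq_b1.
    apply: (@le_trans _ _ ((q0 ^+ l0)^-1 * q0 ^+ r)); last first.
      by apply: ler_wpM2r; [exact: ltW|rewrite /C; lra].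
    rewrite mulrC ler_pdivlMr ?exprn_gt0 // mul1r.
    by apply: ler_wiXn2l; [exact: ltW|case/andP: q001 => _ /ltW|exact: ltnW].
  apply: le_trans (@upcrossings_within_prob R mu s t l0 g r k M mu_law s0 st
    (ltn0Sn _) geo (ltn0Sn _) K2 Kth Keps lr rk) _.
  rewrite -/eps -/theta -/q -exprVn.
  have a1 : (1 + theta)^-1 ^+ r <= q0 ^+ r.
    apply: lerXn2r; rewrite ?nnegrE ?invr_ge0 ?(ltW q00) //; first by lra.
    by rewrite le_max lexx.
  have a2 : q ^+ r <= q0 ^+ r.
    apply: lerXn2r; rewrite ?nnegrE ?expR_ge0 ?(ltW q00) //.
    by rewrite le_max lexx orbT.
  have := ler_wpM2r (ltW i1) a2.
  have : 0 < (q0 ^+ l0)^-1 * q0 ^+ r by apply: mulr_gt0.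
  by rewrite /C !mulrDl; lra.
apply: (le_trans SC); rewrite -mulrA; apply: ler_wpM2l => //.
have [rho0 rho1] : 0 < rho /\ rho < 1 by apply/andP.
rewrite mulrC ler_pdivlMr // -exprSr.
apply: (@le_trans _ _ ((rho ^+ d) ^+ r.+1)).
  by apply: lerXn2r; rewrite ?nnegrE ?(ltW q00) ?exprn_ge0 ?(ltW rho0).
by rewrite -exprM; apply: ler_wiXn2l => //; exact: ltW.
Qed.

(** * From words to the process *)

Section Process.
Context (d : measure_display) (T : measurableType d) (R : realType)
  (P : probability T R) (X : nat -> {RV P >-> bool}).

Definition sample_word (m n : nat) (w : T) : seq bool :=
  mkseq (fun i => X (m + i)%N w) n.

Lemma sample_wordS m n w : sample_word m n.+1 w = X m w :: sample_word m.+1 n w.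
Proof.
rewrite /sample_word /mkseq /= addn0 (iotaDl 1 0 n) -map_comp; congr cons.
by apply: eq_map => i /=; rewrite addnA addn1.
Qed.

Lemma sample_wordSr m n w :
  sample_word m n.+1 w = rcons (sample_word m n w) (X (m + n)%N w).
Proof. exact: mkseqS. Qed.

Lemma take_sample_word m n M w : (n <= M)%N ->
  take n (sample_word m M w) = sample_word m n w.
Proof. by move=> nM; rewrite /sample_word /mkseq -map_take take_iota (minn_idPl nM). Qed.

Lemma tval_block m n w : tval (block X m n w) = sample_word m n w.
Proof.
rewrite /block /sample_word /mkseq /= -val_enum_ord -map_comp.
exact: eq_map.
Qed.

Lemma block_eq m n w (x : n.-tuple bool) :
  (block X m n w = x) = (sample_word m n w = x :> seq bool).
Proof.
rewrite -tval_block; apply/propext; split=> [->//|h]; exact: val_inj.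
Qed.

Lemma measurable_coordinate n b : measurable [set w | X n w = b].
Proof.
by rewrite (_ : [set w | _] = X n @^-1` [set b]) //; apply: (measurable_funPTI (X n)).
Qed.

Lemma measurable_sample_word (Q : seq bool -> Prop) m n :
  measurable [set w | Q (sample_word m n w)].
Proof.
elim: n m Q => [|n IH] m Q.
  have [q|nq] := pselect (Q [::]).
    by rewrite (_ : [set w | _] = setT) //; apply/seteqP; split.
  by rewrite (_ : [set w | _] = set0) //; apply/seteqP; split.
rewrite (_ : [set w | _] =
  ([set w | X m w = true] `&` [set w | Q (true :: sample_word m.+1 n w)]) `|`
  ([set w | X m w = false] `&` [set w | Q (false :: sample_word m.+1 n w)])).
  apply: measurableU; apply: measurableI; try exact: measurable_coordinate.
    exact: (IH m.+1 (fun s => Q (true :: s))).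
  exact: (IH m.+1 (fun s => Q (false :: s))).
apply/seteqP; split=> w /=; rewrite sample_wordS; last by case=> -[->].
by case: (X m w); [left|right].
Qed.

Definition prob (A : set T) : R := fine (P A).

Lemma prob_split n (A : set T) : measurable A ->
  prob A = prob (A `&` [set w | X n w = true]) + prob (A `&` [set w | X n w = false]).
Proof.
move=> mA; rewrite /prob -fineD ?fin_num_measure //;
  try by apply: measurableI => //; exact: measurable_coordinate.
rewrite -measureU; try by apply: measurableI => //; exact: measurable_coordinate.
  congr (fine (P _)); apply/seteqP; split=> w /=; last by case=> -[].
  by case: (X n w) => Aw; [left|right].
by apply/seteqP; split=> w //= [[_ ->] []].
Qed.

(** The set A collects the conditions on the letters already read. *)
Lemma prob_sum_words (Q : seq bool -> Prop) m n (A : set T) : measurable A ->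
  prob (A `&` [set w | Q (sample_word m n w)]) =
  \sum_(x : n.-tuple bool) prob (A `&` [set w | sample_word m n w = x]) * (`[< Q x >])%:R.
Proof.
elim: n m A Q => [|n IH] m A Q mA.
  rewrite (sum_words0 _ (fun x => prob (A `&` [set w | sample_word m 0 w = x]) * (`[< Q x >])%:R)).
  have -> : [set w | sample_word m 0 w = [::]] = setT by apply/seteqP; split.
  case: asboolP => q; rewrite ?mulr1 ?mulr0.
    by rewrite (_ : [set w | _] = setT) //; apply/seteqP; split.
  rewrite (_ : [set w | _] = set0) ?setI0 /prob ?measure0 //.
  by apply/seteqP; split.
rewrite (sum_wordsS _ n (fun x => prob (A `&` [set w | sample_word m n.+1 w = x]) * (`[< Q x >])%:R)).
rewrite (prob_split m); last by apply: measurableI => //; exact: measurable_sample_word.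
have half b : prob (A `&` [set w | Q (sample_word m n.+1 w)] `&` [set w | X m w = b]) =
    \sum_(x : n.-tuple bool)
       prob (A `&` [set w | sample_word m n.+1 w = b :: x]) * (`[< Q (b :: x) >])%:R.
  rewrite (_ : _ `&` _ =
     (A `&` [set w | X m w = b]) `&` [set w | Q (b :: sample_word m.+1 n w)]); last first.
    apply/seteqP; split=> w /=; rewrite sample_wordS.
      by move=> [[Aw +] <-].
    by move=> [[Aw ->]].
  rewrite (IH m.+1 _ (fun s => Q (b :: s))); last first.
    by apply: measurableI => //; exact: measurable_coordinate.
  apply: eq_bigr => x _; congr (prob _ * _).
  apply/seteqP; split=> w /=; rewrite sample_wordS.
    by move=> [[Aw ->] ->].
  by move=> [Aw [-> ->]].
by rewrite !half.
Qed.

Definition process_law (x : seq bool) : R :=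
  prob [set w | sample_word 0 (size x) w = x].

Lemma pathprob_process_law n w :
  pathprob X (block X 0 n w) = process_law (sample_word 0 n w).
Proof.
rewrite /pathprob /process_law size_mkseq; congr (fine (P _)).
by apply/funext => v /=; rewrite block_eq tval_block.
Qed.

Lemma sample_word_law : stationary X -> word_law R process_law.
Proof.
move=> statX; split.
- by move=> x; apply: fine_ge0.
- rewrite /process_law /prob (_ : [set w | _] = setT) ?probability_setT //.
  by apply/seteqP; split.
- move=> x; have -> : process_law x = prob [set w | sample_word 1 (size x) w = x].
    have := statX 1%N (size x) (in_tuple x); rewrite /process_law /prob.
    have eqw m : [set w | block X m (size x) w = in_tuple x] =
        [set w | sample_word m (size x) w = x].
      by apply/funext => v /=; rewrite block_eq.
    by rewrite !eqw => ->.
  rewrite (prob_split 0); last exact: (measurable_sample_word (fun s => s = x)).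
  congr (_ + _); congr prob; apply/seteqP; split=> w /=; rewrite sample_wordS.
  + by move=> [-> ->].
  + by move=> [-> ->].
  + by move=> [-> ->].
  + by move=> [-> ->].
- move=> x; rewrite [RHS](prob_split (size x)); last first.
    exact: (measurable_sample_word (fun s => s = x)).
  rewrite /process_law !size_rcons.
  congr (_ + _); congr prob; apply/seteqP; split=> w /=; rewrite sample_wordSr add0n.
  + by move/rcons_inj => [-> ->].
  + by move=> [-> ->].
  + by move/rcons_inj => [-> ->].
  + by move=> [-> ->].
Qed.

Lemma information_rate_lt n w s : (0 < n)%N ->
  (information_rate X n w < s) = (- ln (process_law (sample_word 0 n w)) < s * ln 2 * n%:R).
Proof.
move=> n0; rewrite /information_rate /information pathprob_process_law /log2.
have ln2 : 0 < ln 2 :> R by apply: ln_gt0; rewrite ltr1n.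
by rewrite ltr_pdivrMl ?ltr0n // -mulNr ltr_pdivrMr // mulrC mulrA mulrAC [ln 2 * _]mulrC.
Qed.

Lemma information_rate_gt n w t : (0 < n)%N ->
  (t < information_rate X n w) = (t * ln 2 * n%:R < - ln (process_law (sample_word 0 n w))).
Proof.
move=> n0; rewrite /information_rate /information pathprob_process_law /log2.
have ln2 : 0 < ln 2 :> R by apply: ln_gt0; rewrite ltr1n.
by rewrite ltr_pdivlMl ?ltr0n // -mulNr ltr_pdivlMr // mulrC mulrA mulrAC [ln 2 * _]mulrC.
Qed.

Definition upcrossing_event (k M : nat) (s t : R) : set T :=
  [set w | exists i j, upcrossings_within R process_law k M (s * ln 2) (t * ln 2)
                         (sample_word 0 M w) i j].

(** Finitely many upcrossings use finitely many indices, so they all occur up to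
    some time M. *)
Lemma has_upcrossings_bigcup k s t :
  [set w | has_upcrossings k s t (fun n => information_rate X n w)] =
  \bigcup_M upcrossing_event k M s t.
Proof.
apply/seteqP; split=> w.
  move=> [i [j [h1 h2 h3]]].
  pose M := (\sum_(m < k) j m)%N.
  have jM m : (m < k)%N -> (j m <= M)%N.
    by move=> mk; rewrite /M (bigD1 (Ordinal mk)) // leq_addr.
  exists M => //; exists i, j; split=> //.
    by move=> m mk; split; [exact: h1|exact: jM].
  move=> m mk; have /andP[i0 ij] := h1 m mk; have [] := h3 m mk.
  rewrite information_rate_lt // information_rate_gt ?(leq_trans _ ij) //.
  by rewrite !take_sample_word ?jM // ltnW // (leq_trans ij) // jM.
move=> [M _ [i [j [h1 h2 h3]]]]; exists i, j; split=> //.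
  by move=> m /h1[].
move=> m mk; have [/andP[i0 ij] jM] := h1 m mk; have := h3 m mk.
rewrite information_rate_lt // information_rate_gt ?(leq_trans _ ij) //.
by rewrite !take_sample_word // ltnW // (leq_trans ij).
Qed.

Lemma upcrossing_event_homo k s t :
  {homo (fun M => upcrossing_event k M s t) : M M' / (M <= M')%N >-> (M <= M')%O}.
Proof.
move=> M M' MM'; apply/subsetPset => w [i [j [h1 h2 h3]]].
exists i, j; split=> //.
  by move=> m /h1[h jM]; split=> //; apply: leq_trans MM'.
move=> m mk; have [/andP[i0 ij] jM] := h1 m mk; have := h3 m mk.
have iM : (i m <= M)%N by rewrite ltnW // (leq_trans ij).
by rewrite !take_sample_word // (leq_trans _ MM').
Qed.

Lemma measurable_upcrossing_event k M s t : measurable (upcrossing_event k M s t).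
Proof.
exact: (measurable_sample_word (fun x => exists i j,
  upcrossings_within R process_law k M (s * ln 2) (t * ln 2) x i j)).
Qed.

Lemma prob_upcrossing_event k M s t : P (upcrossing_event k M s t) =
  (\sum_(x : M.-tuple bool) process_law x *
     (`[< exists i j, upcrossings_within R process_law k M (s * ln 2) (t * ln 2) x i j >])%:R)%:E.
Proof.
rewrite -[LHS]fineK; last first.
  by apply: fin_num_measure; exact: measurable_upcrossing_event.
congr EFin; rewrite -/(prob _) -[X in prob X]setTI.
rewrite /upcrossing_event (prob_sum_words (fun x => exists i j,
  upcrossings_within R process_law k M (s * ln 2) (t * ln 2) x i j)) //.
by apply: eq_bigr => x _; rewrite setTI /process_law size_tuple.
Qed.

End Process.

Theorem theorem1p3 (R : realType) (s t : R) (hst : s < t) :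
  exists c rho : R,
    0 < rho < 1 /\
    forall (d : measure_display) (T : measurableType d) (P : probability T R)
           (X : nat -> {RV P >-> bool}),
      stationary X ->
      forall k : nat, (0 < k)%N ->
        (P [set w | has_upcrossings k s t (fun n => information_rate X n w)]
           < (c * rho ^+ k)%:E)%E.
Proof.
have ln2 : 0 < ln 2 :> R by apply: ln_gt0; rewrite ltr1n.
have st2 : s * ln 2 < t * ln 2 by rewrite ltr_pM2r.
have [c [rho [c0 rho01 decay]]] := upcrossings_within_decay _ _ _ st2.
exists (c + 1), rho; split=> // d T P X statX k k0.
have mu_law := sample_word_law _ _ _ _ _ statX.
apply: (@le_lt_trans _ _ (c * rho ^+ k)%:E); last first.
  by rewrite lte_fin mulrDl mul1r ltrDl exprn_gt0 //; case/andP: rho01.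
rewrite has_upcrossings_bigcup.
have mU M := measurable_upcrossing_event _ _ _ P X k M s t.
have ev_lim := nondecreasing_cvg_mu mU (bigcupT_measurable _ mU)
  (upcrossing_event_homo _ _ _ P X k s t).
apply: (cvge_to_le (ev_lim _ P)); apply: nearW => M /=.
by rewrite prob_upcrossing_event lee_fin; apply: decay.
Qed.
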